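(* Let $G=(V,E)$ be an infinite graph with countable vertex set and maximum degree $\Delta(G)<\infty$. If $G$ does not have the shrink property, then for every $p\in[0,1]$ the $I(G,p)$-model is not of type $\mathcal{I}$.
   Context: Shrink property. For $v\in V$ and $S\subset V$, $deg_S(v)$ is the number of neighbours of $v$ lying in $S$. $G$ has the shrink property if for each non-empty finite subset $S\subset V$ there exists $u\in S$ with $deg_{V\setminus S}(u)\ge deg_S(u)$. The $I(G,p)$-model. Let $\Sigma=\{+1,-1\}^V$. The $I(G,p)$-model is the right-continuous Markov process $(\sigma_t)_{t\ge0}$ on $\Sigma$ whose initial state $\sigma_0$ has i.i.d. spins equal to $+1$ with probability $p$ and $-1$ with probability $1-p$, and whose generator acts on local functions by $(Lf)(\sigma)=\sum_{v\in V}c(v,\sigma)(f(\sigma^v)-f(\sigma))$, where $\sigma^v$ is $\sigma$ with the spin at $v$ reversed and, with $\Delta\mathcal{H}_v(\sigma)=2\sum_{u:\{u,v\}\in E}\sigma(u)\sigma(v)$, $c(v,\sigma)=0$ if $\Delta\mathcal{H}_v(\sigma)>0$, $c(v,\sigma)=1/2$ if $\Delta\mathcal{H}_v(\sigma)=0$, $c(v,\sigma)=1$ if $\Delta\mathcal{H}_v(\sigma)<0$. A vertex fixates if its spin flips only finitely many times; the model is of type $\mathcal{I}$ if almost surely no vertex fixates. *)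

(* Defs.v *)
From HB Require Import structures.
From mathcomp Require Import all_boot all_order all_algebra finmap.
From mathcomp Require Import all_classical all_reals all_analysis.

Set Implicit Arguments.
Unset Strict Implicit.
Unset Printing Implicit Defensive.

Import Order.TTheory GRing.Theory Num.Theory.
Import numFieldNormedType.Exports.

Local Open Scope classical_set_scope.
Local Open Scope card_scope.
Local Open Scope ring_scope.

Record graph (V : Type) := Graph {
  adj :> rel V;
  adj_sym : symmetric adj;
  adj_irr : irreflexive adj }.

Section Graphs.
Context {V : countType} (G : graph V).

Definition neighbours (v : V) : set V := [set u | G v u].

(* [fset_set] of an infinite set is empty, so [deg A v] is a genuine count only
   when [A `&` neighbours v] is finite, e.g. in a graph of bounded degree. *)
Definition deg (A : set V) (v : V) : nat :=
  #|` fset_set (A `&` neighbours v)|.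

(* The finiteness of neighbourhoods is part of the condition, see [deg]. *)
Definition finite_max_degree : Prop :=
  exists D : nat, forall v, neighbours v #<= `I_D.

Definition shrink_property : Prop :=
  forall S : set V, S !=set0 -> finite_set S ->
    exists2 u, S u & (deg S u <= deg (~` S) u)%N.

End Graphs.

(* Configurations, with the product topology; [true] stands for the spin +1
   and [false] for the spin -1. *)
Notation config V := {ptws V -> bool}.

Definition spin (b : bool) : int := if b then 1 else -1.

Definition flip {V : eqType} (x : config V) (v : V) : config V :=
  fun u => if u == v then ~~ x u else x u.

Definition local_fun {R : realType} {V : choiceType} (f : config V -> R) :=
  exists A : {fset V}, forall x y : config V,
    {in A, x =1 y} -> f x = f y.

Section Generator.
Context {R : realType} {V : countType} (G : graph V).

Definition deltaH (v : V) (x : config V) : int :=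
  2 * \sum_(u \in neighbours G v) spin (x u) * spin (x v).

Definition rate (v : V) (x : config V) : R :=
  if 0 < deltaH v x then 0 else if deltaH v x == 0 then 2^-1 else 1.

(* For a local [f] only finitely many terms of the sum are nonzero. *)
Definition generator (f : config V -> R) (x : config V) : R :=
  \sum_(v \in [set: V]) rate v x * (f (flip x v) - f x).

End Generator.

(* [S t] is only specified for [0 <= t] and on continuous functions: it is a
   Markov semigroup on C({+1,-1}^V) in the sense of Liggett. *)
Record markov_semigroup {R : realType} {V : countType}
    (S : R -> (config V -> R) -> config V -> R) : Prop := MarkovSemigroup {
  semigroup_continuous : forall (t : R) (f : config V -> R), 0 <= t ->
    continuous f -> continuous (S t f);
  semigroup_linear : forall (t a : R) (f g : config V -> R),
    0 <= t -> continuous f -> continuous g ->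
    S t (fun x => a * f x + g x) = (fun x => a * S t f x + S t g x);
  semigroup_ge0 : forall (t : R) (f : config V -> R), 0 <= t -> continuous f ->
    (forall x, 0 <= f x) -> forall x, 0 <= S t f x;
  semigroup_cst1 : forall t : R, 0 <= t -> S t (fun=> 1) = (fun=> 1);
  semigroup0 : forall f : config V -> R, continuous f -> S 0 f = f;
  semigroupD : forall (s t : R) (f : config V -> R), 0 <= s -> 0 <= t -> continuous f ->
    S (s + t) f = S s (S t f);
  semigroup_right_continuous : forall (t : R) (f : config V -> R), 0 <= t -> continuous f ->
    {uniform, S ^~ f @ t^'+ --> S t f} }.

(* The generator of [S] is defined at every local function and is given there
   by [generator G]. *)
Definition has_generator {R : realType} {V : countType} (G : graph V)
    (S : R -> (config V -> R) -> config V -> R) : Prop :=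
  forall f, local_fun f ->
    {uniform, (fun t x => t^-1 * (S t f x - f x)) @ 0^'+ --> generator G f}.

Section Process.
Context {R : realType} {V : countType} {d : measure_display}
  {T : measurableType d} (P : probability T R).

(* A process is [sigma t w v]: the spin of vertex [v] at time [t] for the
   outcome [w]; only the times [0 <= t] matter. *)
Implicit Type sigma : R -> T -> config V.

Definition past sigma (s : R) : set_system T :=
  <<s [set A | exists (r : R) v, 0 <= r <= s /\ A = [set w | sigma r w v]] >>.

(* E[f(sigma_(s+t)) | past up to s] = (S t f)(sigma_s) for continuous f. *)
Definition markov_process (S : R -> (config V -> R) -> config V -> R) sigma :=
  forall (s t : R) (A : set T) (f : config V -> R), 0 <= s -> 0 <= t ->
    past sigma s A -> continuous f ->
    (\int[P]_(w in A) (f (sigma (s + t)%R w))%:E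
     = \int[P]_(w in A) (S t f (sigma s w))%:E)%E.

Definition mutually_independent (X : V -> T -> bool) :=
  forall (A : {fset V}) (B : V -> set bool),
    P (\bigcap_(v in [set` A]) X v @^-1` B v)
    = (\prod_(v <- A) P (X v @^-1` B v))%E.

Record I_model (G : graph V) (p : R) sigma : Prop := IModel {
  model_measurable : forall (t : R) v, 0 <= t ->
    measurable_fun setT (fun w => sigma t w v);
  model_right_continuous : forall (t : R) w, 0 <= t ->
    sigma ^~ w @ t^'+ --> sigma t w;
  model_initial_indep : mutually_independent (fun v w => sigma 0 w v);
  model_initial_plus : forall v, P [set w | sigma 0 w v = true] = p%:E;
  model_initial_minus : forall v, P [set w | sigma 0 w v = false] = (1 - p)%:E;
  model_markov : exists S,
    [/\ markov_semigroup S, has_generator G S & markov_process S sigma] }.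

(* The spin path of a vertex being right-continuous, its flips are the times
   at which it is not left-continuous. *)
Definition flip_times sigma (v : V) (w : T) : set R :=
  [set t | 0 < t /\ ~ (sigma s w v @[s --> t^'-] --> sigma t w v)].

Definition fixates sigma (v : V) (w : T) : Prop :=
  finite_set (flip_times sigma v w).

Definition type_I sigma : Prop :=
  {ae P, forall w, forall v, ~ fixates sigma v w}.

End Process.

(* Main.v *)
(* If S violates the shrink property, every vertex of S has a strict majority
   of its neighbours in S. For a spin b of positive initial probability, let f
   be the indicator of the event that all of S has spin b. A vertex of S cannot
   flip when S is aligned, so L f >= 0; hence exp(tL) f >= f, and exp(tL) f = 1
   on {f = 1}. By the Markov property, f(sigma_0) = 1 implies f(sigma_t) = 1
   almost surely for each t, and by right-continuity for all t simultaneously.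
   So with positive probability the vertices of S never flip. *)
Require Import Defs.
From mathcomp Require Import all_boot all_order all_algebra finmap lra.
From mathcomp Require Import all_classical all_reals all_analysis.
Import Order.TTheory GRing.Theory Num.Theory.
Import numFieldNormedType.Exports.
Local Open Scope classical_set_scope.
Local Open Scope ring_scope.

(** * Energy cost of a flip inside an aligned set *)

Section Graph.
Context {V : countType} (G : graph V).

Definition aligned (S : set V) (b : bool) : set (config V) :=
  [set x | forall v, S v -> x v = b].

Lemma finite_neighbours v : finite_max_degree G -> finite_set (neighbours G v).
Proof.
move=> [D /(_ v) ND]; exact: card_le_finite ND (finite_II D).
Qed.

Lemma mul_spin (a b : bool) : spin a * spin b = if a == b then 1 else -1.
Proof. by case: a; case: b. Qed.

(** Neighbours inside [S] each contribute 1 to the sum and those outside at least -1, so the strict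
    majority makes it positive. *)
Lemma deltaH_gt0 (S : set V) (b : bool) (x : config V) v :
  finite_set (neighbours G v) -> (deg G (~` S) v < deg G S v)%N ->
  aligned S b x -> S v -> 0 < deltaH G v x.
Proof.
move=> Nfin degS xb Sv; rewrite /deltaH pmulr_rgt0//.
have fin A : finite_set (A `&` neighbours G v) by exact: finite_setIr.
rewrite -[neighbours G v]setTI -(setUv S) setIUl fsbigU0//=; last first.
  by move=> u /= [[? _] []].
rewrite fsbig_finite//= [X in _ + X]fsbig_finite//=.
have -> : \sum_(u <- fset_set (S `&` neighbours G v)) spin (x u) * spin (x v) =
    (deg G S v)%:Z.
  rewrite (eq_big_seq (fun=> 1))
    ?big_const_seq ?count_predT ?iter_addr_0 ?natz//.
  move=> u; rewrite in_fset_set// inE => -[Su _].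
  by rewrite mul_spin !xb// eqxx.
have : - (deg G (~` S) v)%:Z <=
    \sum_(u <- fset_set (~` S `&` neighbours G v)) spin (x u) * spin (x v).
  rewrite -natz /deg -sum1_size natr_sum -sumrN; apply: ler_sum => u _.
  by rewrite mul_spin; case: ifP.
rewrite -(lerD2l (deg G S v)%:Z); apply: lt_le_trans.
by rewrite subr_gt0 ltz_nat.
Qed.
End Graph.

(** Fixing finitely many coordinates gives a neighbourhood, as [bool] is discrete. The semigroup
    axioms apply to continuous functions only. *)
Lemma local_fun_continuous {R : realType} {V : countType} (f : config V -> R) :
  local_fun f -> continuous f.
Proof.
move=> [A fA] x U /nbhs_singleton Ufx.
have : nbhs x (\bigcap_(v in [set` A]) [set y : config V | y v = x v]).
  apply: filter_bigI => v _.
  have /(_ x) := @proj_continuous V (fun=> bool) v; move/discrete_cvg; exact.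
apply: filterS => y xy; rewrite /= (fA y x)// => v vA; exact: xy.
Qed.

(** * Subharmonic local functions under the semigroup *)

Section Semigroup.
Context {R : realType} {V : countType} (G : graph V).

Section Aligned.
Variables (S : set V) (b : bool).
Hypotheses (Gfin : finite_max_degree G) (Sfin : finite_set S).
Hypothesis Sdeg : forall v, S v -> (deg G (~` S) v < deg G S v)%N.

Lemma local_indic_aligned : local_fun (\1_(aligned S b) : config V -> R).
Proof.
exists (fset_set S) => x y xy; rewrite !indicE; congr (_%:R : R).
congr nat_of_bool.
apply/idP/idP; rewrite !inE => xb v Sv.
  by rewrite -xy ?xb// in_fset_set// inE.
by rewrite xy ?xb// in_fset_set// inE.
Qed.

Lemma generator_indic_aligned_ge0 x :
  0 <= generator G (\1_(aligned S b) : config V -> R) x.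
Proof.
apply: fsumr_ge0 => v _; have [xS|xS] := pselect (aligned S b x).
  have [Sv|Sv] := pselect (S v).
    rewrite /rate (@deltaH_gt0 _ _ S b)// ?mul0r//.
      exact: finite_neighbours.
    exact: Sdeg.
  rewrite !indicE !mem_set ?subrr ?mulr0// => u Su.
  by rewrite /flip; case: eqP => [uv|_]; [rewrite uv in Su|exact: xS].
(* Off the aligned configurations the indicator is 0, so no flip can lower it. *)
rewrite [X in _ - X]indicE memNset// subr0 mulr_ge0//.
by rewrite /rate; case: ifP => // _; case: ifP => _; rewrite ?invr_ge0 ?ler0n.
Qed.
End Aligned.

Variable S : R -> (config V -> R) -> config V -> R.
Hypotheses (Smarkov : markov_semigroup S) (SG : has_generator G S).

Lemma semigroup_le t f g : 0 <= t -> continuous f -> continuous g ->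
  (forall x, f x <= g x) -> forall x, S t f x <= S t g x.
Proof.
move=> t0 fc gc fg x.
have -> : g = (fun x => 1 * (fun y => g y - f y) x + f x).
  by apply/funext => y; rewrite mul1r subrK.
have gfc : continuous (fun y => g y - f y).
  by move=> y; exact: cvgB (gc y) (fc y).
rewrite (semigroup_linear Smarkov)// mul1r lerDr.
by apply: (semigroup_ge0 Smarkov) => // y; rewrite subr_ge0.
Qed.

Lemma semigroup_ge_subharmonic (f : config V -> R) t x :
  local_fun f -> (forall y, 0 <= generator G f y) -> 0 <= t -> f x <= S t f x.
Proof.
move=> floc Lf0 t0; have fc := local_fun_continuous _ floc.
suff lb e : 0 < e -> f x - t * e <= S t f x.
  apply/ler_addgt0Pr => e e0; rewrite -lerBlDr.
  (* Dividing by [t + 1] instead of [t] also covers [t = 0]. *)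
  have t1 : 0 < t + 1 by rewrite ltr_wpDl.
  apply: le_trans (lb (e / (t + 1)) _); last by rewrite divr_gt0.
  by rewrite lerD2l lerN2 mulrCA ler_piMr ?(ltW e0)// ler_pdivrMr// mul1r lerDl.
move=> e0.
(* The generator gives this bound for small times; the semigroup property then
   propagates it to t in steps of length t / n. *)
have : \forall h \near 0^'+, forall y, f y - h * e <= S h f y.
  have /(_ [set g | forall y, - e < g y]) := SG _ floc.
  (* Uniform convergence yields one threshold for [h] valid at all configurations, as the iteration
     below requires. *)
  have near_gen : nbhs (generator G f : {uniform config V -> R})
      [set g | forall y, - e < g y].
    apply/uniform_nbhs; exists [set ab | `|ab.1 - ab.2| < e]; split.
      exact: entourage_ball (PosNum e0).
    move=> g /= ge y; have := ge y Logic.I; have := Lf0 y.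
    rewrite ltr_norml => ? /andP[? ?]; lra.
  move=> /(_ near_gen); apply: filterS2 (nbhs_right_gt 0) => h h0 he y.
  have := he y; rewrite mulrC ltr_pdivlMr// => /ltW; lra.
case=> d /= d0 small.
have step n h y : 0 < h < d -> f y - (n%:R * h) * e <= S (n%:R * h) f y.
  move=> /andP[h0 hd]; elim: n y => [|n IH] y.
    by rewrite !mul0r subr0 (semigroup0 Smarkov).
  have nh0 : 0 <= n%:R * h by rewrite mulr_ge0 ?ler0n ?ltW.
  have hf z : f z - h * e <= S h f z.
    by apply: small => //=; rewrite sub0r normrN gtr0_norm.
  rewrite -natr1 mulrDl mul1r (semigroupD Smarkov)// ?(ltW h0)//.
  (* The loss [h * e] is written as a multiple of the constant function 1, which the semigroup
     preserves; linearity then takes it out. *)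
  have -> : f y - (n%:R * h + h) * e = - (h * e) * 1 + (f y - n%:R * h * e).
    by rewrite mulr1 mulrDl; lra.
  apply: (@le_trans _ _ (S (n%:R * h) (fun z => - (h * e) * 1 + f z) y)).
    rewrite (semigroup_linear Smarkov) ?(semigroup_cst1 Smarkov)//.
      by rewrite lerD2l.
    exact: cst_continuous.
  apply: semigroup_le => //.
  - by move=> z; apply: cvgD; [exact: cvg_cst|exact: fc].
  - by apply: (semigroup_continuous Smarkov) => //; exact: ltW.
  - by move=> z; rewrite mulr1 addrC.
(* With [n] above [t / d], the step length [t / n] is below [d]; it must also be positive, so
   [t = 0] is treated apart. *)
have := archi_boundP (divr_ge0 t0 (ltW d0)); set n := Num.bound _ => tn.
move: t0; rewrite le_eqVlt => /predU1P[<-|t0].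
  by rewrite mul0r subr0 (semigroup0 Smarkov).
have n0 : 0 < n%:R :> R by apply: le_lt_trans tn; rewrite divr_ge0// ltW.
have tE : n%:R * (t / n%:R) = t by rewrite mulrC divfK// gt_eqF.
rewrite -[in leLHS]tE -[in leRHS]tE; apply: step.
by rewrite divr_gt0//= ltr_pdivrMr// mulrC -ltr_pdivrMr.
Qed.

(** The upper bound compares the indicator with the constant 1; the lower bound is
    subharmonicity. *)
Lemma semigroup_indic_aligned (A : set V) (b : bool) t x :
  finite_max_degree G -> finite_set A ->
  (forall v, A v -> (deg G (~` A) v < deg G A v)%N) ->
  0 <= t -> aligned A b x -> S t \1_(aligned A b) x = 1.
Proof.
move=> Gfin Afin Adeg t0 xb; have loc := local_indic_aligned A b Afin.
apply/eqP; rewrite eq_le; apply/andP; split.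
  rewrite -[leRHS]/((fun=> 1) x) -(semigroup_cst1 Smarkov t0).
  apply: semigroup_le => //; first exact: local_fun_continuous.
  exact: cst_continuous.
apply: le_trans (semigroup_ge_subharmonic _ t x loc _ t0).
  by rewrite indicE mem_set.
by move=> y; exact: generator_indic_aligned_ge0.
Qed.
End Semigroup.

(** * Alignment persists along almost every path *)

Section Process.
Context {R : realType} {V : countType} {G : graph V} {p : R}
  {d : measure_display} {T : measurableType d} {P : probability T R}
  {sigma : R -> T -> config V}.
Hypothesis model : I_model P G p sigma.

Variables (S : set V) (b : bool).
Hypotheses (Gfin : finite_max_degree G) (Sfin : finite_set S).
Hypothesis Sdeg : forall v, S v -> (deg G (~` S) v < deg G S v)%N.

Lemma aligned_bigcap (t : R) : [set w | aligned S b (sigma t w)] =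
  \bigcap_(v in S) [set w | sigma t w v = b].
Proof. by apply/seteqP; split. Qed.

Lemma measurable_aligned t : 0 <= t ->
  measurable [set w | aligned S b (sigma t w)].
Proof.
move=> t0; rewrite aligned_bigcap; apply: fin_bigcap_measurable => // v _.
have := model_measurable model v t0.
by move=> /(_ measurableT [set b] I); rewrite setTI.
Qed.

Lemma past_aligned : past sigma 0 [set w | aligned S b (sigma 0 w)].
Proof.
rewrite aligned_bigcap /past.
set K := [set _ | _].
apply: (@fin_bigcap_measurable _ (g_sigma_algebraType K)) => // v _.
have mv : <<s K >> [set w | sigma 0 w v].
  by apply: sub_gen_smallest; exists 0, v; rewrite lexx.
case: b => //.
(* The generators of [past] are events of spin [true]; spin [false] is their complement. *)
rewrite (_ : mkset _ = ~` [set w | sigma 0 w v]).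
  exact: (@measurableC _ (g_sigma_algebraType K)).
by apply/seteqP; split => w /=; [move=> -> | move/negP/negbTE].
Qed.

(** The Markov property at time 0, integrated over the initially aligned outcomes [A], gives [B] and
    [A] together the full probability of [A], since the integrand is 1 on [A]. *)
Lemma negligible_unaligned t : 0 <= t ->
  P.-negligible [set w | aligned S b (sigma 0 w) /\ ~ aligned S b (sigma t w)].
Proof.
move=> t0; set A := [set w | aligned S b (sigma 0 w)].
set B := [set w | aligned S b (sigma t w)].
have mA : measurable A by exact: measurable_aligned.
have mB : measurable B by exact: measurable_aligned.
have [Q [Qmarkov QG Qsigma]] := model_markov model.
have PBA : P (B `&` A) = P A.
  have := Qsigma 0 t A (\1_(aligned S b)) (lexx 0) t0 past_aligned
    (local_fun_continuous _ (local_indic_aligned S b Sfin)).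
  rewrite add0r => intE.
  transitivity (\int[P]_(w in A) (\1_B w)%:E)%E.
    by rewrite integral_indic.
  transitivity (\int[P]_(w in A) (\1_A w)%:E)%E; last first.
    by rewrite integral_indic// setIid.
  rewrite -[LHS]/(\int[P]_(w in A) (\1_(aligned S b) (sigma t w))%:E)%E intE.
  apply: eq_integral => w; rewrite inE => wA.
  by rewrite (semigroup_indic_aligned G)// indicE mem_set.
rewrite -[X in P.-negligible X]/(A `\` B); apply/negligibleP.
  exact: measurableD.
rewrite measureD//; last by rewrite ltey_eq fin_num_measure.
transitivity (P A - P A)%E; last by rewrite subee ?fin_num_measure.
by congr (_ - _)%E; rewrite setIC; exact: PBA.
Qed.

Lemma negligible_ever_unaligned :
  P.-negligible [set w | aligned S b (sigma 0 w) /\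
    exists2 t, 0 <= t & ~ aligned S b (sigma t w)].
Proof.
(* Enumerates the nonnegative rational times; codes of no rational are sent to 0. *)
pose q n : R := `|ratr (odflt 0 (choice.unpickle n) : rat)|.
apply: negligibleS (negligible_bigcup
  (fun n => negligible_unaligned (q n) (normr_ge0 _))).
move=> w [w0 [t t0 wt]].
have [v [Sv wv]] : exists v, S v /\ sigma t w v <> b.
  by apply: contra_notP wt => H v Sv; apply: contra_notP H => ?; exists v.
(* A wrong spin at time [t] persists for a short while, hence is seen at some rational time. *)
have : \forall s \near t^'+, sigma s w v = sigma t w v.
  have vt := cvg_comp _ _ (model_right_continuous model t0)
    (@proj_continuous V (fun=> bool) v (sigma t w)).
  exact: vt (discrete_set1 (sigma t w v)).
case=> e /= e0 near_t.
have [r] := @rat_in_itvoo R t (t + e) (ltac:(by rewrite ltrDl)).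
rewrite in_itv/= => /andP[tr re].
exists (choice.pickle r) => //.
rewrite /q choice.pickleK/= gtr0_norm ?(le_lt_trans t0)//.
split => // /(_ v Sv); rewrite near_t//=.
by rewrite distrC gtr0_norm ?subr_gt0// ltrBlDl.
Qed.

Lemma fixates_of_constant (v : V) w :
  (forall t, 0 <= t -> sigma t w v = b) -> fixates sigma v w.
Proof.
move=> wv; rewrite /fixates (_ : flip_times _ _ _ = set0)//.
apply/seteqP; split => // t [t0]; apply.
apply: cvg_near_cst; apply: filterS (nbhs_left_gt t0) => s s0.
by rewrite !wv// ltW.
Qed.

Lemma prob_aligned : P [set w | aligned S b (sigma 0 w)] =
  (\prod_(v <- fset_set S) P [set w | sigma 0 w v = b])%E.
Proof.
rewrite aligned_bigcap -(model_initial_indep model _ (fun=> [set b])).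
by rewrite fset_setK.
Qed.

(** Were the model of type I, every initially aligned outcome would lie in one of two null sets:
    some vertex fixates, or alignment is lost at some time. *)
Lemma not_type_I : S !=set0 -> (0 < P [set w | aligned S b (sigma 0 w)])%E ->
  ~ type_I P sigma.
Proof.
move=> [v Sv] + typeI; apply/negP.
rewrite -leNgt le_eqVlt; apply/orP; left; apply/eqP.
apply/negligibleP; first exact: measurable_aligned.
apply: negligibleS (negligibleU typeI negligible_ever_unaligned) => w w0.
have [wt|wt] := pselect (forall t, 0 <= t -> aligned S b (sigma t w)).
  left => /(_ v); apply; apply: fixates_of_constant => t t0; exact: wt.
right; split => //; apply: contra_notP wt => H t t0.
by apply: contra_notP H => ?; exists t.
Qed.
End Process.

Theorem theorem2 (R : realType) (V : countType) (G : graph V) :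
  infinite_set [set: V] -> finite_max_degree G -> ~ shrink_property G ->
  forall p : R, 0 <= p <= 1 ->
  forall (d : measure_display) (T : measurableType d) (P : probability T R)
    (sigma : R -> T -> config V),
  I_model P G p sigma -> ~ type_I P sigma.
Proof.
move=> _ Gfin noshrink p _ d T P sigma model.
have [S [S0 Sfin Sdeg]] : exists S, [/\ S !=set0, finite_set S &
    forall v, S v -> (deg G (~` S) v < deg G S v)%N].
  apply: contra_notP noshrink => H S S0 Sfin; apply: contra_notP H => H.
  exists S; split => // v Sv; rewrite ltnNge; apply/negP => vle.
  by apply: H; exists v.
have [b Pb] : exists b, forall v, (0 < P [set w | sigma 0%R w v = b])%E.
  (* If [p] is not positive, then [1 - p] is, so spin [false] serves. *)
  have [p0|p0] := ltP 0 p.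
    by exists true => v; rewrite (model_initial_plus model) lte_fin.
  exists false => v; rewrite (model_initial_minus model) lte_fin; lra.
apply: (not_type_I model S b) => //.
rewrite (prob_aligned model S b)//; elim/big_ind : _ => //.
exact: mule_gt0.
Qed.
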